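(* For every QBF $\Phi=\Pi.\phi$, the following algorithm terminates. Algorithm: with $U$ the universal and $E$ the existential variables of $\Pi$, set $A_0:=\{\alpha_0\}$ for an arbitrary full assignment $\alpha_0\colon U\to\{\top,\bot\}$, $S_0:=\emptyset$, $i:=1$. Repeat: (a) check satisfiability of $\bigwedge_{\alpha\in A_{i-1}}\phi^\alpha$; if unsatisfiable return false, otherwise let $\tau$ be a satisfying assignment (assigning all annotated variables $x^\alpha$, $x\in E$, $\alpha\in A_{i-1}$) and set $S_i:=S_{i-1}\cup\{(\tau|_{E^\alpha})^{-\alpha}\mid \alpha\in A_{i-1}\}$; (b) check satisfiability of $\bigwedge_{\sigma\in S_i}\lnot\phi^\sigma$; if unsatisfiable return true, otherwise let $\rho$ be a satisfying assignment (assigning all $x^\sigma$, $x\in U$, $\sigma\in S_i$) and set $A_i:=A_{i-1}\cup\{(\rho|_{U^\sigma})^{-\sigma}\mid\sigma\in S_i\}$; (c) increment $i$.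
   Context: A QBF is $\Pi.\phi$ where $\Pi=Q_1x_1\ldots Q_nx_n$ with $Q_i\in\{\forall,\exists\}$ and pairwise distinct variables, $X=\{x_1,\dots,x_n\}$, $\phi$ a propositional formula over $X$; $U$ ($E$) is the set of universally (existentially) quantified variables, and $x_i<_\Pi x_j$ iff $i<j$. An assignment for $Y$ is $\sigma\colon Y\to\{\top,\bot,\epsilon\}$ ($\epsilon$ = unassigned), full if it never takes value $\epsilon$; $\sigma|_Z$ is its restriction to $Z$. Instantiation: for an assignment $\sigma$ on a subset of $X$ (extended by $\epsilon$), $\phi^\sigma$ is obtained from $\phi$ by replacing every $x$ with $\sigma(x)\neq\epsilon$ by $\sigma(x)$ (with propositional simplification), and every $x$ with $\sigma(x)=\epsilon$ by the annotated variable $x^\omega$, where $\omega=\sigma(x_{k_1})\cdots\sigma(x_{k_m})$ for $x_{k_1}<_\Pi\cdots<_\Pi x_{k_m}$ all variables preceding $x$, each $\epsilon$ contributing the empty word (empty annotation identifies $x^\omega$ with $x$). Annotated variables with the same name and annotation are the same variable. Write $x^\sigma$ for the variable replacing $x$ in $\phi^\sigma$, $E^\sigma=\{x^\sigma: x\in E,\sigma(x)=\epsilon\}$, $U^\sigma=\{x^\sigma:x\in U,\sigma(x)=\epsilon\}$. For an assignment $\tau$ to annotated variables, $\tau^{-\sigma}$ is the assignment $x\mapsto\tau(x^\sigma)$. *)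

(* Defs.v *)
From mathcomp Require Import all_boot.
Set Implicit Arguments.
Unset Strict Implicit.
Unset Printing Implicit Defensive.

Inductive form (V : Type) : Type :=
| FConst of bool
| FVar of V
| FNot of form V
| FAnd of form V & form V
| FOr of form V & form V
| FImp of form V & form V
| FIff of form V & form V.

Arguments FConst {V}.

Fixpoint feval (V : Type) (v : V -> bool) (f : form V) : bool :=
  match f with
  | FConst b => b
  | FVar x => v x
  | FNot g => ~~ feval v g
  | FAnd g h => feval v g && feval v h
  | FOr g h => feval v g || feval v h
  | FImp g h => feval v g ==> feval v h
  | FIff g h => feval v g == feval v h
  end.

Definition satisfiable (V : Type) (f : form V) : Prop :=
  exists v : V -> bool, feval v f.

Fixpoint fsubst (V W : Type) (s : V -> form W) (f : form V) : form W :=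
  match f with
  | FConst b => FConst b
  | FVar x => s x
  | FNot g => FNot (fsubst s g)
  | FAnd g h => FAnd (fsubst s g) (fsubst s h)
  | FOr g h => FOr (fsubst s g) (fsubst s h)
  | FImp g h => FImp (fsubst s g) (fsubst s h)
  | FIff g h => FIff (fsubst s g) (fsubst s h)
  end.

Definition simp_not (V : Type) (f : form V) : form V :=
  if f is FConst b then FConst (~~ b) else FNot f.

Definition simp_and (V : Type) (f g : form V) : form V :=
  match f, g with
  | FConst b, _ => if b then g else FConst false
  | _, FConst b => if b then f else FConst false
  | _, _ => FAnd f g
  end.

Definition simp_or (V : Type) (f g : form V) : form V :=
  match f, g with
  | FConst b, _ => if b then FConst true else g
  | _, FConst b => if b then FConst true else f
  | _, _ => FOr f g
  end.

Definition simp_imp (V : Type) (f g : form V) : form V :=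
  match f, g with
  | FConst b, _ => if b then g else FConst true
  | _, FConst b => if b then FConst true else simp_not f
  | _, _ => FImp f g
  end.

Definition simp_iff (V : Type) (f g : form V) : form V :=
  match f, g with
  | FConst b, _ => if b then g else simp_not g
  | _, FConst b => if b then f else simp_not f
  | _, _ => FIff f g
  end.

Fixpoint simplify (V : Type) (f : form V) : form V :=
  match f with
  | FConst b => FConst b
  | FVar x => FVar x
  | FNot g => simp_not (simplify g)
  | FAnd g h => simp_and (simplify g) (simplify h)
  | FOr g h => simp_or (simplify g) (simplify h)
  | FImp g h => simp_imp (simplify g) (simplify h)
  | FIff g h => simp_iff (simplify g) (simplify h)
  end.

Inductive quantifier : Type := Forall | Exists.

(* The variables are named by their position in the prefix, so that X is
   'I_nvars and the prefix order is the order of 'I_nvars. *)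
Record qbf : Type := QBF {
  nvars : nat;
  quant : 'I_nvars -> quantifier;
  matrix : form 'I_nvars
}.

Definition Uvars (Phi : qbf) : {set 'I_(nvars Phi)} :=
  [set x | if quant x is Forall then true else false].

Definition Evars (Phi : qbf) : {set 'I_(nvars Phi)} :=
  [set x | if quant x is Exists then true else false].

(* Assignments for a subset of X, extended to X by epsilon, which is None. *)
Definition assignment (n : nat) : finType := {ffun 'I_n -> option bool}.

Definition full_assignment_for (n : nat) (Y : {set 'I_n})
    (s : assignment n) : Prop :=
  forall x : 'I_n, (s x != None) = (x \in Y).

(* Annotated variables x^w; (x, [::]) is x itself. *)
Definition avar (n : nat) : eqType := ('I_n * seq bool)%type.

(* The annotated variable x^s: enum 'I_n is increasing, and pmap drops the
   variables y with s y = None. *)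
Definition annotate (n : nat) (s : assignment n) (x : 'I_n) : avar n :=
  (x, pmap s [seq y : 'I_n <- enum 'I_n | y < x]).

Definition instantiate (n : nat) (f : form 'I_n) (s : assignment n) :
    form (avar n) :=
  simplify
    (fsubst (fun x => if s x is Some b then FConst b
                      else FVar (annotate s x)) f).

(* Y^s = { x^s : x in Y, s(x) = epsilon }, used for Y = E and Y = U. *)
Definition annotated_vars (n : nat) (Y : {set 'I_n}) (s : assignment n) :
    seq (avar n) :=
  [seq annotate s x | x in [set x in Y | s x == None]].

Definition restrict (n : nat) (t : avar n -> bool) (Z : seq (avar n)) :
    avar n -> option bool :=
  fun v => if v \in Z then Some (t v) else None.

(* t^{-s}; a variable assigned by s has no counterpart x^s and is left
   unassigned. *)
Definition unannotate (n : nat) (t : avar n -> option bool)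
    (s : assignment n) : assignment n :=
  [ffun x => if s x is Some _ then None else t (annotate s x)].

Definition A_formula (Phi : qbf) (A : {set assignment (nvars Phi)}) :
    form (avar (nvars Phi)) :=
  \big[@FAnd _/FConst true]_(a in A) instantiate (matrix Phi) a.

Definition S_formula (Phi : qbf) (S : {set assignment (nvars Phi)}) :
    form (avar (nvars Phi)) :=
  \big[@FAnd _/FConst true]_(s in S) FNot (instantiate (matrix Phi) s).

(* CheckA i A_{i-1} S_{i-1} is the state before (a), and CheckB i A_{i-1} S_i
   the state before (b). *)
Inductive state (Phi : qbf) : Type :=
| CheckA of nat & {set assignment (nvars Phi)} & {set assignment (nvars Phi)}
| CheckB of nat & {set assignment (nvars Phi)} & {set assignment (nvars Phi)}
| Return of bool.

Arguments Return {Phi}.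

(* The relation is nondeterministic: any satisfying valuation may be picked.
   Valuations are total on annotated variables, but only their restrictions to
   E^a (resp. U^s) enter the next state. *)
Inductive step (Phi : qbf) : state Phi -> state Phi -> Prop :=
| step_a_unsat i A S :
    ~ satisfiable (A_formula A) ->
    step (CheckA i A S) (Return false)
| step_a_sat i A S (tau : avar (nvars Phi) -> bool) :
    feval tau (A_formula A) ->
    step (CheckA i A S)
         (CheckB i A
            (S :|: [set unannotate (restrict tau (annotated_vars (Evars Phi) a)) a
                   | a in A]))
| step_b_unsat i A S :
    ~ satisfiable (S_formula S) ->
    step (CheckB i A S) (Return true)
| step_b_sat i A S (rho : avar (nvars Phi) -> bool) :
    feval rho (S_formula S) ->
    step (CheckB i A S)
         (CheckA i.+1
            (A :|: [set unannotate (restrict rho (annotated_vars (Uvars Phi) s)) s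
                   | s in S])
            S).

Definition initial (Phi : qbf) (a0 : assignment (nvars Phi)) : state Phi :=
  CheckA 1 [set a0] set0.

(* Every execution from the given state, whatever the choices made, returns
   after finitely many steps and never gets stuck. *)
Inductive terminates (Phi : qbf) : state Phi -> Prop :=
| terminates_return b : terminates (Return b)
| terminates_step c :
    (exists c', step c c') ->
    (forall c', step c c' -> terminates c') ->
    terminates c.

(* Main.v *)
(** Every round in which both checks succeed adds an assignment to [A], and there
are only finitely many of them.  Indeed, let [f a] and [g s] be the answers read
off from the valuations [tau] and [rho] of one round.  Since an annotation only
records what precedes a variable, the value of [g (f a)] at [x] depends only on
the values of [a] before [x]; iterating [g \o f] as often as there are variables
therefore reaches a fixed point from any start.  If the round added nothing, [A]
would be stable under [g \o f] and contain a fixed point [a].  But then [tau]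
satisfies the instance by [a] and [rho] falsifies the instance by [f a], while
both evaluate the matrix at the same assignment, the union of [a] and [f a]. *)

Require Import Defs.
From mathcomp Require Import all_boot.
From Stdlib Require Import Classical.

Set Implicit Arguments.
Unset Strict Implicit.
Unset Printing Implicit Defensive.

(** * Evaluation of instances *)

Section Evaluation.
Variable V : Type.
Implicit Types (f g : form V) (v : V -> bool).

Lemma eq_feval v w f : v =1 w -> feval v f = feval w f.
Proof.
by move=> vw; elim: f => //= [f ->|f -> g ->|f -> g ->|f -> g ->|f -> g ->].
Qed.

Lemma feval_simp_not v f : feval v (simp_not f) = ~~ feval v f.
Proof. by case: f. Qed.

Lemma feval_simp_and v f g :
  feval v (simp_and f g) = feval v f && feval v g.
Proof. by case: f => [[]||||||]; case: g => [[]||||||] *; rewrite /= ?andbT ?andbF. Qed.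

Lemma feval_simp_or v f g :
  feval v (simp_or f g) = feval v f || feval v g.
Proof. by case: f => [[]||||||]; case: g => [[]||||||] *; rewrite /= ?orbT ?orbF. Qed.

Lemma feval_simp_imp v f g :
  feval v (simp_imp f g) = feval v f ==> feval v g.
Proof.
by case: f => [[]||||||]; case: g => [[]||||||] *; rewrite /= ?implybT ?implybF.
Qed.

Lemma feval_simp_iff v f g :
  feval v (simp_iff f g) = (feval v f == feval v g).
Proof.
by case: f => [[]||||||]; case: g => [[]||||||] *;
   rewrite /= ?feval_simp_not ?eqb_id ?eqbF_neg // eq_sym ?eqb_id ?eqbF_neg.
Qed.

Lemma feval_simplify v f : feval v (simplify f) = feval v f.
Proof.
elim: f => //= [f IHf|f IHf g IHg|f IHf g IHg|f IHf g IHg|f IHf g IHg].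
- by rewrite feval_simp_not IHf.
- by rewrite feval_simp_and IHf IHg.
- by rewrite feval_simp_or IHf IHg.
- by rewrite feval_simp_imp IHf IHg.
- by rewrite feval_simp_iff IHf IHg.
Qed.

Lemma feval_fsubst (W : Type) (s : V -> form W) (w : W -> bool) f :
  feval w (fsubst s f) = feval (fun x => feval w (s x)) f.
Proof.
by elim: f => //= [f ->|f -> g ->|f -> g ->|f -> g ->|f -> g ->].
Qed.

Lemma feval_bigand (I : finType) (A : {pred I}) (F : I -> form V) v :
  feval v (\big[@FAnd _/FConst true]_(i in A) F i) =
  [forall (i | i \in A), feval v (F i)].
Proof. by rewrite (big_morph (feval v) (op1 := andb) (id1 := true)) // big_andE. Qed.

End Evaluation.

Lemma feval_instantiate n (f : form 'I_n) (s : assignment n) v :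
  feval v (instantiate f s) =
  feval (fun x => odflt (v (annotate s x)) (s x)) f.
Proof.
rewrite /instantiate feval_simplify feval_fsubst.
by apply: eq_feval => x; case: (s x).
Qed.

(** * Answers read off from a valuation *)

(** Common form of the new members of [S] (with [Y] existential) and of [A] (with [Y] universal), so
    that each fact below serves both players. *)
Definition answer n (t : avar n -> bool) (Y : {set 'I_n}) (s : assignment n) :
    assignment n :=
  unannotate (restrict t (annotated_vars Y s)) s.

Lemma mem_annotated_vars n (Y : {set 'I_n}) (s : assignment n) x :
  (annotate s x \in annotated_vars Y s) = (x \in Y) && (s x == None).
Proof.
apply/imageP/idP => [[y] + [-> _]|xY]; first by rewrite inE.
by exists x; rewrite ?inE.
Qed.

Section Answers.
Variable n : nat.
Implicit Types (Y : {set 'I_n}) (s : assignment n) (t : avar n -> bool).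

Lemma answerE t Y s x : full_assignment_for (~: Y) s ->
  answer t Y s x = if x \in Y then Some (t (annotate s x)) else None.
Proof.
move=> /(_ x); rewrite inE ffunE /restrict mem_annotated_vars.
by case: (s x) => [b|] /=; case: (x \in Y).
Qed.

Lemma full_answer t Y s : full_assignment_for (~: Y) s ->
  full_assignment_for Y (answer t Y s).
Proof. by move=> sF x; rewrite answerE //; case: (x \in Y). Qed.

Lemma eq_annotate s s' (x : 'I_n) :
  (forall y : 'I_n, y < x -> s y = s' y) -> annotate s x = annotate s' x.
Proof.
move=> ss'; congr (_, _); apply: eq_in_pmap => y.
by rewrite mem_filter => /andP[/ss'].
Qed.

Lemma eq_answer t Y s s' (x : 'I_n) :
  full_assignment_for (~: Y) s -> full_assignment_for (~: Y) s' ->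
  (forall y : 'I_n, y < x -> s y = s' y) -> answer t Y s x = answer t Y s' x.
Proof. by move=> sF s'F ss'; rewrite !answerE // (eq_annotate ss'). Qed.

(** On [Y], the value that [t] supplies on the left is the constant substituted on the right. Off
    [Y], the fixed-point hypothesis makes the constant [s x] the value that [r] supplies on the
    right. *)
Lemma feval_instantiate_answer (f : form 'I_n) t r Y s :
  full_assignment_for (~: Y) s -> s = answer r (~: Y) (answer t Y s) ->
  feval t (instantiate f s) = feval r (instantiate f (answer t Y s)).
Proof.
move=> sF sE; have aF := full_answer t sF.
rewrite !feval_instantiate; apply: eq_feval => x.
(* Only the value of [s] at [x] is to be unfolded by the fixed-point equation; the second rewrite
   restores [s] inside the annotation. *)
rewrite [in LHS]sE -{1}sE.
rewrite (answerE _ _ sF) (@answerE r) ?setCK // inE.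
by case: (x \in Y).
Qed.

(* The iterates [k] and [k.+1] agree on the first [k] variables. *)
Lemma answer_fixpoint t r Y s : full_assignment_for (~: Y) s ->
  exists k, let a := iter k (fun a => answer r (~: Y) (answer t Y a)) s in
    full_assignment_for (~: Y) a /\ a = answer r (~: Y) (answer t Y a).
Proof.
move=> sF; pose h a := answer r (~: Y) (answer t Y a).
have hF a : full_assignment_for (~: Y) a -> full_assignment_for (~: Y) (h a).
  by move=> aF; apply: full_answer; rewrite setCK; apply: full_answer.
have iF k : full_assignment_for (~: Y) (iter k h s).
  by elim: k => //= k; apply: hF.
have agree k (x : 'I_n) : x < k -> iter k h s x = iter k.+1 h s x.
  elim: k x => // k IHk x xk; rewrite -[LHS]/(h _ x) -[RHS]/(h (iter k.+1 h s) x).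
  (* Locality is used once per player; [z < y < x <= k] brings [z] within the induction
     hypothesis. *)
  apply: eq_answer; rewrite ?setCK; do ?exact/full_answer/iF.
  move=> y yx; apply: eq_answer; [exact: iF | exact: (iF k.+1)|].
  by move=> z zy; apply: IHk; rewrite (ltn_trans zy) // (leq_trans yx).
(* All indices are below [n], so agreement on the first [n] variables is equality. *)
exists n; split; first exact: iF.
by apply/ffunP => x; apply: agree.
Qed.

End Answers.

(** * Termination *)

Section Termination.
Variable Phi : qbf.
Local Notation n := (nvars Phi).
Local Notation U := (Uvars Phi).
Local Notation E := (Evars Phi).
Implicit Types (A S : {set assignment n}) (tau rho : avar n -> bool).

Lemma Uvars_setC : U = ~: E.
Proof. by apply/setP => x; rewrite !inE; case: (quant x). Qed.

Lemma round_progress A S tau rho :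
  A != set0 -> {in A, forall a, full_assignment_for U a} ->
  feval tau (A_formula A) ->
  {in A, forall a, answer tau E a \in S} ->
  feval rho (S_formula S) ->
  A \proper A :|: [set answer rho U s | s in S].
Proof.
case/set0Pn => a0 a0A AF; rewrite /A_formula feval_bigand => /forall_inP tauA AS.
rewrite /S_formula feval_bigand => /forall_inP rhoS.
rewrite properE subsetUl; apply/negP; rewrite subUset subxx /= => /subsetP SA.
have := AF _ a0A; rewrite {1}Uvars_setC => /(answer_fixpoint tau rho)[k].
set h := fun a => answer rho _ _; set a := iter k h a0 => -[aF aE].
(* The orbit of [a0] never leaves [A]: first answers lie in [S] by [AS], and the replies to them in
   [A] by [SA]. *)
have aA : a \in A.
  rewrite /a; elim: (k) => //= j IHj; apply: SA.
  by rewrite {1}/h -Uvars_setC; apply/imset_f/AS.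
have := rhoS _ (AS _ aA); rewrite /= -(feval_instantiate_answer _ aF aE).
by rewrite tauA.
Qed.

Lemma stepA_inv i A S c : step (CheckA i A S) c ->
  c = Return false \/
  exists2 tau, feval tau (A_formula A) &
    c = CheckB i A (S :|: [set answer tau E a | a in A]).
Proof.
move=> st; inversion st as [| ? ? ? tau tauA | |]; subst; first by left.
by right; exists tau.
Qed.

Lemma stepB_inv i A S c : step (CheckB i A S) c ->
  c = Return true \/
  exists2 rho, feval rho (S_formula S) &
    c = CheckA i.+1 (A :|: [set answer rho U s | s in S]) S.
Proof.
move=> st; inversion st as [| | | ? ? ? rho rhoS]; subst; first by left.
by right; exists rho.
Qed.

(** Satisfiability is a bare proposition, so excluded middle selects the transition that applies. *)
Lemma CheckA_step i A S : exists c, step (CheckA i A S) c.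
Proof.
have [[tau tauA]|unsat] := classic (satisfiable (A_formula A)).
  by eexists; apply: step_a_sat tauA.
by exists (Return false); apply: step_a_unsat.
Qed.

Lemma CheckB_step i A S : exists c, step (CheckB i A S) c.
Proof.
have [[rho rhoS]|unsat] := classic (satisfiable (S_formula S)).
  by eexists; apply: step_b_sat rhoS.
by exists (Return true); apply: step_b_unsat.
Qed.

(** Induction on the number of assignments outside [A], which drops in each round where both checks
    succeed. Fullness of [S] is carried along to keep the new members of [A] full. *)
Lemma CheckA_terminates i A S :
  A != set0 -> {in A, forall a, full_assignment_for U a} ->
  {in S, forall s, full_assignment_for E s} ->
  terminates (CheckA i A S).
Proof.
have [m] := ubnP #|~: A|; elim: m => // m IHm in i A S *.
rewrite ltnS => Am A0 AF SF.
apply: terminates_step (CheckA_step i A S) _ => c.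
case/stepA_inv => [->|[tau tauA ->]]; first exact: terminates_return.
set S' := S :|: _.
have AS' : {in A, forall a, answer tau E a \in S'}.
  by move=> a aA; rewrite inE imset_f ?orbT.
have S'F : {in S', forall s, full_assignment_for E s}.
  move=> s /setUP[/SF //|/imsetP[a /AF aF ->]].
  by apply: full_answer; rewrite -Uvars_setC.
apply: terminates_step (CheckB_step i A S') _ => {}c.
case/stepB_inv => [->|[rho rhoS ->]]; first exact: terminates_return.
have AA' := round_progress A0 AF tauA AS' rhoS.
apply: IHm => //.
- by rewrite (leq_trans _ Am) // proper_card // properC.
- by apply: contraNneq A0 => A'0; rewrite -subset0 -A'0 subsetUl.
- move=> a /setUP[/AF //|/imsetP[s /S'F sF ->]].
  by apply: full_answer; rewrite Uvars_setC setCK.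
Qed.

End Termination.

Theorem theorem2 (Phi : qbf) (alpha0 : assignment (nvars Phi))
    (halpha0 : full_assignment_for (Uvars Phi) alpha0) :
  terminates (initial alpha0).
Proof.
apply: CheckA_terminates => [|a /set1P -> //|s]; last by rewrite inE.
by apply/set0Pn; exists alpha0; rewrite set11.
Qed.
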